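(* Let $\mathcal{H}$ be a class of functions $\mathcal{X}\to\mathbb{R}$ with finite covering dimension $d=\mathrm{Cdim}(\mathcal{H})$, in the noisy binary feedback model with loss $|y-y'|$ and flip probability $p<1/2$. Fix $p'$ with $p<p'<1/2$ and let $N=N_{T^{-2}}(\mathcal{H})$. Consider the algorithm: $w_1(f)=1/|N|$ for $f\in N$; in round $t$, let $m_t$ be a weighted median of $\{f(x_t):f\in N\}$ with respect to $w_t$ (i.e. $\sum_{f:f(x_t)\ge m_t}w_t(f)\ge\frac12$ and $\sum_{f:f(x_t)\le m_t}w_t(f)\ge\frac12$); choose $y_t$ uniformly at random in $[m_t-\frac1T,m_t+\frac1T]$; set $\hat w_{t+1}(f)=p'\,w_t(f)$ if $\sigma_t(y_t-f(x_t))<0$ and $\hat w_{t+1}(f)=(1-p')\,w_t(f)$ otherwise; and normalize $w_{t+1}(f)=\hat w_{t+1}(f)/\sum_{f'\in N}\hat w_{t+1}(f')$. Then this algorithm incurs expected regret $\mathbb{E}\big[\sum_{t=1}^T|y_t-f_0(x_t)|\big]=O(d\log T)$.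
   Context: Noisy binary feedback model: $\mathcal{H}$ is a class of functions from a context set $\mathcal{X}$ to $\mathbb{R}$ (losses between hypothesis values lie in $[0,1]$). An adversary fixes $f_0\in\mathcal{H}$; in each round $t=1,\dots,T$ it chooses $x_t\in\mathcal{X}$, the learner guesses $y_t$, incurs loss $|y_t-f_0(x_t)|$, and receives $\sigma_t$, which equals $+1$ if $y_t>f_0(x_t)$ and $-1$ if $y_t<f_0(x_t)$, except that with probability $p$ (independently each round) it is flipped. $d_\infty(f_1,f_2)=\sup_{x}|f_1(x)-f_2(x)|$; $N_\varepsilon(\mathcal{H})$ is a minimum-cardinality subset $S\subseteq\mathcal{H}$ such that every $h\in\mathcal{H}$ has $h'\in S$ with $d_\infty(h,h')\le\varepsilon$; $\mathrm{Cdim}(\mathcal{H})=\sup_{0<\varepsilon\le1/2}\log|N_\varepsilon(\mathcal{H})|/\log(1/\varepsilon)$. Constants in $O(\cdot)$ may depend on $p,p'$.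
   Formalization: The bound proved is C·max(d log T, 1) with C depending only on p and p', in place of O(d log T); for a one-function class (d = 0) the regret is 1/2, so the unguarded bound fails. For d > 0 and T ≥ e^{1/d} the bound is C·d log T. *)

(* Defs.v *)
From mathcomp Require Export all_boot all_order all_algebra finmap.
From mathcomp Require Export all_classical all_reals all_analysis.
Export Order.TTheory GRing.Theory Num.Theory.
Export numFieldNormedType.Exports.

Set Implicit Arguments.
Unset Strict Implicit.
Unset Printing Implicit Defensive.

Global Open Scope classical_set_scope.
Global Open Scope ring_scope.

Section Covering.
Context {R : realType} {X : Type}.
Implicit Types (H : set (X -> R)) (eps : R) (S N : {fset (X -> R)}).

Definition dinf (f1 f2 : X -> R) : \bar R :=
  ereal_sup [set (`|f1 x - f2 x|)%:E | x in [set: X]].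

Definition is_cover eps H S : Prop :=
  (forall f, f \in S -> H f) /\
  (forall h, H h -> exists2 h', h' \in S & (dinf h h' <= eps%:E)%E).

Definition is_min_cover eps H N : Prop :=
  is_cover eps H N /\ forall S, is_cover eps H S -> (#|` N| <= #|` S|)%N.

(* Equal to +oo when there is no finite cover. *)
Definition covering_number eps H : \bar R :=
  ereal_inf [set (#|` S|%:R)%:E | S in is_cover eps H].

Definition Cdim H : \bar R :=
  ereal_sup [set (lne (covering_number eps H) / (ln eps^-1)%:E)%E
            | eps in [set eps : R | 0 < eps <= 2^-1]].

End Covering.

Section Weights.
Context {R : realType} {X : Type}.

(* Rounds are numbered from 0, so [weights N p' x y sigma t] is the weight
   vector used in round t, after the t updates of rounds 0, ..., t - 1. *)
Fixpoint weights (N : {fset (X -> R)}) (p' : R) (x : nat -> X)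
    (y sigma : nat -> R) (t : nat) : (X -> R) -> R :=
  match t with
  | 0%N => fun=> (#|` N|%:R)^-1
  | s.+1 =>
    let w := weights N p' x y sigma s in
    let what f :=
      (if sigma s * (y s - f (x s)) < 0 then p' else 1 - p') * w f in
    fun f => what f / \sum_(g <- N) what g
  end.

Definition weighted_median (N : {fset (X -> R)}) (w : (X -> R) -> R) (x : X)
    (m : R) : Prop :=
  2^-1 <= \sum_(f <- N | m <= f x) w f /\
  2^-1 <= \sum_(f <- N | f x <= m) w f.

End Weights.

Section Model.
Context {R : realType} {X : Type} {d : measure_display}
  {Omega : measurableType d} (P : probability Omega R).

Definition filtration (F : nat -> set (set Omega)) : Prop :=
  [/\ forall t, sigma_algebra setT (F t),
      forall t, F t `<=` measurable &
      forall t, F t `<=` F t.+1].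

Definition measurable_wrt (G : set (set Omega)) {d'} {Y : measurableType d'}
    (Z : Omega -> Y) : Prop :=
  forall B : set Y, measurable B -> G (Z @^-1` B).

(* [F t] is the information available before the guess of round t: all past
   guesses and feedback, and any private randomness of the adversary.  Since
   [x t] is only required to be [F t]-measurable, the adversary is adaptive.
   X carries the sigma-algebra generated by H, i.e. measurability of [x t]
   means measurability of [f (x t)] for all f in H.  The value of [sigma t] is
   unspecified when [y t = f0 (x t)]. *)
Record noisy_feedback (H : set (X -> R)) (f0 : X -> R) (p : R) (T : nat)
    (F : nat -> set (set Omega)) (x : nat -> Omega -> X)
    (y : nat -> Omega -> R) (flip : nat -> Omega -> bool)
    (sigma : nat -> Omega -> R) : Prop := {
  nf_filtration : filtration F ;
  nf_context : forall t f, (t < T)%N -> H f ->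
    measurable_wrt (F t) (fun w => f (x t w)) ;
  nf_guess : forall t, (t < T)%N -> measurable_wrt (F t.+1) (y t) ;
  nf_flip : forall t, (t < T)%N -> measurable_wrt (F t.+1) (flip t) ;
  nf_sigma : forall t, (t < T)%N -> measurable_wrt (F t.+1) (sigma t) ;
  (* [flip t] is Bernoulli(p), independent of the past and of [y t] *)
  nf_flip_law : forall t (A : set Omega) (B : set R) (b : set bool),
    (t < T)%N -> F t A -> measurable B ->
    P (A `&` y t @^-1` B `&` flip t @^-1` b) =
    (P (A `&` y t @^-1` B) * bernoulli_prob p b)%E ;
  nf_above : forall t w, (t < T)%N -> f0 (x t w) < y t w ->
    sigma t w = if flip t w then -1 else 1 ;
  nf_below : forall t w, (t < T)%N -> y t w < f0 (x t w) ->
    sigma t w = if flip t w then 1 else -1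
}.

Lemma oppV_lt_V (T : nat) : (0 < T)%N -> - (T%:R^-1 : R) < T%:R^-1.
Proof. by move=> T0; rewrite gtrN// invr_gt0 ltr0n. Qed.

(* [ma_guess_law] says that, conditionally on the past, [y t] is uniform on
   [m t - 1/T, m t + 1/T].  Any adapted choice among the weighted medians is
   allowed. *)
Record median_algorithm (N : {fset (X -> R)}) (p' : R) (T : nat)
    (T0 : (0 < T)%N) (F : nat -> set (set Omega)) (x : nat -> Omega -> X)
    (m y sigma : nat -> Omega -> R) : Prop := {
  ma_adapted : forall t, (t < T)%N -> measurable_wrt (F t) (m t) ;
  ma_median : forall t w, (t < T)%N ->
    weighted_median N (weights N p' (x^~ w) (y^~ w) (sigma^~ w) t)
      (x t w) (m t w) ;
  ma_guess_law : forall t (A : set Omega) (B : set R),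
    (t < T)%N -> F t A -> measurable B ->
    P (A `&` [set w | B (y t w - m t w)]) =
    (P A * uniform_prob (oppV_lt_V T0) B)%E
}.

Definition expected_regret (f0 : X -> R) (T : nat) (x : nat -> Omega -> X)
    (y : nat -> Omega -> R) : \bar R :=
  'E_P[fun w => \sum_(t < T) `|y t w - f0 (x t w)|].

End Model.

(* Main.v *)
Require Import Defs.
From mathcomp Require Import measurable_realfun ring lra.

(** Let [g] be a point of the cover [N] closest to [f0].  The weight of [g] is
    at most [1] and starts at [1/|N|], so [ln w_t(g)] increases by at most
    [ln |N| <= 2 d ln T] over the game.  Unless [y_t] is so close to [f0(x_t)]
    that [g] and [f0] may lie on different sides of it (or ties with a point of
    the cover), [ln z <= z - 1] bounds the increase in round [t] below by
    [(1 - 2 p') r_t] times [1/(1 - p')] without a flip and times [-1/p'] with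
    one, where [r_t] is the weight of the functions that [y_t] separates from
    [f0].  The flip being independent of [r_t], the expected increase is at
    least a positive multiple of [E r_t], since [p < p'].  Exceptional rounds
    have probability at most [1/T] because [y_t] is uniform on an interval of
    length [2/T].  If the median [m_t] is further than [2/T] from [f0(x_t)],
    then with probability one half [y_t] falls strictly between them and
    [r_t >= 1/2].  Hence the expected number of such rounds is
    [O(ln |N| + 1)]; all other rounds cost at most [3/T] each. *)

(** * Weights along a trajectory *)

Section PathwiseWeights.
Context {R : realType} {X : Type} (N : {fset (X -> R)}) (p' : R).
Variables (x : nat -> X) (y sigma : nat -> R).
Hypotheses (p'_gt0 : 0 < p') (p'_lt2 : p' < 2^-1) (N_gt0 : (0 < #|` N|)%N).

Let w := weights N p' x y sigma.

Definition factor (t : nat) (f : X -> R) : R :=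
  if sigma t * (y t - f (x t)) < 0 then p' else 1 - p'.

Definition factor_sum (t : nat) : R := \sum_(f <- N) factor t f * w t f.

Lemma weightsS t f : w t.+1 f = factor t f * w t f / factor_sum t.
Proof. by []. Qed.

Lemma factor_ge t f : p' <= factor t f.
Proof. by move: p'_gt0 p'_lt2; rewrite /factor; case: ifP => _; lra. Qed.

Lemma factor_le t f : factor t f <= 1 - p'.
Proof. by move: p'_gt0 p'_lt2; rewrite /factor; case: ifP => _; lra. Qed.

(** Positivity and normalization go through one induction: the update divides by [factor_sum], whose
    positivity at round [t] uses both facts at round [t]. *)
Lemma weights_pos_sum t : (forall f, 0 < w t f) /\ \sum_(f <- N) w t f = 1.
Proof.
elim: t => [|t [IHpos IHsum]].
  split=> [f|]; first by rewrite /w/= invr_gt0 ltr0n.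
  rewrite /w/= big_const_seq count_predT iter_addr_0 -[X in X *+ _]mul1r.
  by rewrite -mulrnAr -mulr_natr mul1r mulVf// pnatr_eq0 -lt0n.
have W0 : 0 < factor_sum t.
  apply: (@lt_le_trans _ _ (p' * \sum_(f <- N) w t f)); first by rewrite IHsum mulr1.
  rewrite mulr_sumr; apply: ler_sum => f _.
  by rewrite ler_wpM2r ?factor_ge// ltW.
split=> [f|].
  by rewrite weightsS divr_gt0// mulr_gt0// (lt_le_trans p'_gt0)// factor_ge.
under eq_bigr do rewrite weightsS.
by rewrite -mulr_suml divff// gt_eqF.
Qed.

Lemma weights_gt0 t f : 0 < w t f.
Proof. by case: (weights_pos_sum t). Qed.

Lemma weights_sum1 t : \sum_(f <- N) w t f = 1.
Proof. by case: (weights_pos_sum t). Qed.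

Lemma weights_le1 t f : f \in N -> w t f <= 1.
Proof.
move=> fN; rewrite -(weights_sum1 t) (big_fsetD1 f)//= lerDl sumr_ge0// => g _.
exact/ltW/weights_gt0.
Qed.

Lemma factor_sum_gt0 t : 0 < factor_sum t.
Proof.
apply: (@lt_le_trans _ _ (p' * \sum_(f <- N) w t f)); first by rewrite weights_sum1 mulr1.
rewrite mulr_sumr; apply: ler_sum => f _.
by rewrite ler_wpM2r ?factor_ge// ltW// weights_gt0.
Qed.

Lemma sum_factor_diff t g :
  \sum_(f <- N) (factor t g - factor t f) * w t f = factor t g - factor_sum t.
Proof.
under eq_bigr do rewrite mulrBl.
by rewrite sumrB -mulr_sumr weights_sum1 mulr1.
Qed.

(* Linearizing [ln z <= z - 1] here makes the bound affine in the weights, so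
   that no logarithm is ever integrated. *)
Lemma ln_weights_step t g :
  (\sum_(f <- N) (factor t g - factor t f) * w t f) / factor t g
  <= ln (w t.+1 g) - ln (w t g).
Proof.
have c0 : 0 < factor t g by rewrite (lt_le_trans p'_gt0)// factor_ge.
have W0 := factor_sum_gt0 t; have w0 := weights_gt0 t g.
rewrite sum_factor_diff.
have lnW : ln (factor_sum t / factor t g) <= factor_sum t / factor t g - 1.
  rewrite -[X in ln X](subrKC 1); apply: le_ln1Dx.
  by rewrite ltrBrDl subrr divr_gt0.
rewrite weightsS mulrAC lnM ?posrE ?divr_gt0// addrK -[in leRHS]invf_div lnV ?posrE ?divr_gt0//.
by rewrite mulrBl divff ?gt_eqF//; lra.
Qed.

(** This is the quantity r_t of the overview. *)
Definition opposed_mass (f0 : X -> R) (t : nat) : R :=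
  \sum_(f <- N) w t f *
    ((f0 (x t) < y t) && (y t < f (x t)) ||
     (f (x t) < y t) && (y t < f0 (x t)))%:R.

Lemma opposed_mass_ge0 f0 t : 0 <= opposed_mass f0 t.
Proof.
by apply: sumr_ge0 => f _; rewrite mulr_ge0// ltW// weights_gt0.
Qed.

Lemma opposed_mass_le1 f0 t : opposed_mass f0 t <= 1.
Proof.
rewrite -(weights_sum1 t); apply: ler_sum => f _.
by rewrite ler_piMr ?lern1 ?leq_b1// ltW// weights_gt0.
Qed.

(** The first clause covers guesses that may separate [f0] from its approximation in the cover. The
    second covers ties, where [factor] is [1 - p'] whatever the feedback says. *)
Definition bad_guess (f0 : X -> R) (eps : R) (t : nat) : bool :=
  (`|y t - f0 (x t)| <= eps) || has (fun f => y t == f (x t)) N.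

(** Without a flip, [g] has factor [1 - p'] and an opposed function has factor [p']; a flip
    exchanges the two. This is the resulting difference relative to the factor of [g], with the
    common [1 - 2 * p'] taken out. *)
Definition progress (fl : bool) : R :=
  if fl then - p'^-1 else (1 - p')^-1.

(** In a good round every cover function on the side of [g] has the same factor as [g] and cancels,
    and only the opposed ones contribute. The linearized bound then equals the left-hand side
    exactly. *)
Lemma ln_weights_step_good f0 g eps t fl :
  `|f0 (x t) - g (x t)| <= eps -> ~~ bad_guess f0 eps t ->
  (f0 (x t) < y t -> sigma t = if fl then -1 else 1) ->
  (y t < f0 (x t) -> sigma t = if fl then 1 else -1) ->
  (1 - 2 * p') * opposed_mass f0 t * progress fl
  <= ln (w t.+1 g) - ln (w t g).
Proof.
move=> fg; rewrite negb_or -ltNge => /andP[far /hasPn neqN] above below.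
apply: le_trans (ln_weights_step t g).
rewrite le_eqVlt; apply/orP; left; apply/eqP.
move: fg; rewrite ler_norml => /andP[fg1 fg2].
suff E f : f \in N -> (factor t g - factor t f) / factor t g =
   (1 - 2 * p') * progress fl * ((f0 (x t) < y t) && (y t < f (x t)) ||
     (f (x t) < y t) && (y t < f0 (x t)))%:R.
  rewrite /opposed_mass mulr_sumr mulr_suml mulr_suml.
  apply: eq_big_seq => f fN.
  by rewrite [RHS]mulrAC E//; ring.
have [p'0 p'2] := (p'_gt0, p'_lt2).
move=> fN; have := neqN f fN; rewrite neq_lt => yf.
have p0 : p' != 0 by rewrite gt_eqF.
have p1 : 1 - p' != 0 by rewrite gt_eqF//; lra.
(* The margin [eps] also puts [g] strictly on the same side of the guess as [f0]. *)
have [yf0|yf0] : f0 (x t) + eps < y t \/ y t < f0 (x t) - eps.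
- by move: far; rewrite lter_normr => /orP[] h; [left|right]; lra.
- have s1 : f0 (x t) < y t by lra.
  rewrite /factor /progress (above s1) s1 (lt_gtF s1) andbF orbF/=.
  case: fl above below => _ _; rewrite ?mulN1r ?mul1r ?oppr_lt0 ?subr_gt0 ?subr_lt0.
  + have -> : g (x t) < y t by lra.
    by case/orP: yf => yf; rewrite ?yf ?(lt_gtF yf)/=; field; rewrite ?p0 ?p1.
  + have -> : (y t < g (x t)) = false by apply/negbTE; rewrite -leNgt; lra.
    by case/orP: yf => yf; rewrite ?yf ?(lt_gtF yf)/=; field; rewrite ?p0 ?p1.
- have s1 : y t < f0 (x t) by lra.
  rewrite /factor /progress (below s1) s1 (lt_gtF s1) andbT/=.
  case: fl above below => _ _; rewrite ?mulN1r ?mul1r ?oppr_lt0 ?subr_gt0 ?subr_lt0.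
  + have -> : y t < g (x t) by lra.
    by case/orP: yf => yf; rewrite ?yf ?(lt_gtF yf)/=; field; rewrite ?p0 ?p1.
  + have -> : (g (x t) < y t) = false by apply/negbTE; rewrite -leNgt; lra.
    by case/orP: yf => yf; rewrite ?yf ?(lt_gtF yf)/=; field; rewrite ?p0 ?p1.
Qed.

(** The worst case is that [g] receives the smallest factor [p'] while [factor_sum] is as large as
    [1 - p']; the linearized bound is then [1 - (1 - p') / p']. *)
Lemma ln_weights_step_bad g t :
  - ((1 - 2 * p') / p') <= ln (w t.+1 g) - ln (w t g).
Proof.
apply: le_trans (ln_weights_step t g).
have c0 : 0 < factor t g by rewrite (lt_le_trans p'_gt0)// factor_ge.
rewrite sum_factor_diff.
have W1 : factor_sum t <= 1 - p'.
  rewrite -[leRHS]mulr1 -[X in _ <= _ * X](weights_sum1 t) mulr_sumr; apply: ler_sum => f _.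
  by rewrite ler_wpM2r ?factor_le// ltW// weights_gt0.
have -> : - ((1 - 2 * p') / p') = 1 - (1 - p') / p'.
  by field; rewrite gt_eqF.
rewrite [leRHS]mulrBl divff ?gt_eqF// lerD2l lerN2.
apply: (@le_trans _ _ ((1 - p') / factor t g)).
  by rewrite ler_wpM2r// invr_ge0 ltW.
by rewrite ler_wpM2l ?lef_pV2 ?posrE ?factor_ge//; move: p'_gt0 p'_lt2; lra.
Qed.

(** The increments of [ln (w t g)] telescope, from minus the logarithm of the cover size to at most
    0. The possible losses of the bad rounds are moved to the right-hand side. *)
Lemma total_progress_le f0 g eps (flip : nat -> bool) (T : nat) : g \in N ->
  (forall t, (t < T)%N -> `|f0 (x t) - g (x t)| <= eps) ->
  (forall t, (t < T)%N -> f0 (x t) < y t -> sigma t = if flip t then -1 else 1) ->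
  (forall t, (t < T)%N -> y t < f0 (x t) -> sigma t = if flip t then 1 else -1) ->
  \sum_(t < T) (~~ bad_guess f0 eps t)%:R *
     ((1 - 2 * p') * opposed_mass f0 t * progress (flip t))
  <= ln #|` N|%:R + (1 - 2 * p') / p' * \sum_(t < T) (bad_guess f0 eps t)%:R.
Proof.
move=> gN fg above below; rewrite -lerBlDr mulr_sumr -sumrB.
apply: (@le_trans _ _ (\sum_(t < T) (ln (w t.+1 g) - ln (w t g)))).
  apply: ler_sum => t _; case: (boolP (bad_guess f0 eps t)) => [bad|good].
    by rewrite /= mul0r sub0r mulr1 ln_weights_step_bad.
  rewrite /= mul1r mulr0 subr0.
  by apply: ln_weights_step_good good _ _; [exact: fg|exact: above|exact: below].
rewrite -(big_mkord xpredT (fun t => ln (w t.+1 g) - ln (w t g))) telescope_sumr//.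
rewrite [ln (w 0%N g)]/= lnV ?posrE ?ltr0n// opprK.
by rewrite gerDr ln_le0// weights_le1.
Qed.

End PathwiseWeights.

(** * Covers and medians *)

Section Cover.
Context {R : realType} {X : Type}.
Implicit Types (H : set (X -> R)) (N : {fset (X -> R)}).

Lemma covering_number_min eps H N : is_min_cover eps H N ->
  covering_number eps H = (#|` N|%:R)%:E.
Proof.
move=> [cN minN]; apply/eqP; rewrite eq_le; apply/andP; split.
  by apply: ereal_inf_lbound; exists N.
by apply/ereal_infP => _ [S cS <-]; rewrite lee_fin ler_nat minN.
Qed.

Lemma is_cover_card_gt0 eps H N f : is_cover eps H N -> H f -> (0 < #|` N|)%N.
Proof. by move=> [_ cN] /cN[g gN _]; rewrite cardfs_gt0; apply/fset0Pn; exists g. Qed.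

Lemma dinf_le (f g : X -> R) eps x : (dinf f g <= eps%:E)%E -> `|f x - g x| <= eps.
Proof.
by move=> fg; rewrite -lee_fin; apply: le_trans fg; apply: ereal_sup_ubound; exists x.
Qed.

(** The radius is one of those in the supremum defining [Cdim], and [ln eps^-1] is positive there,
    so the quotient can be cleared. *)
Lemma ln_card_min_cover_le H N d eps : 0 < eps <= 2^-1 -> (0 < #|` N|)%N ->
  Cdim H = d%:E -> is_min_cover eps H N -> ln #|` N|%:R <= d * ln eps^-1.
Proof.
move=> /andP[eps0 eps2] N0 HCdim minN.
have l0 : 0 < ln eps^-1 by rewrite ln_gt0// invf_gt1//; lra.
have : (lne (covering_number eps H) / (ln eps^-1)%:E <= d%:E)%E.
  by rewrite -HCdim; apply: ereal_sup_ubound; exists eps => //; rewrite /= eps0.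
rewrite (covering_number_min _ _ _ minN) lne_EFin ?ltr0n// inver gt_eqF//.
by rewrite -EFinM lee_fin ler_pdivrMr.
Qed.

End Cover.

Section Median.
Context {R : realType} {X : Type} (N : {fset (X -> R)}).

(** Neither sum in the definition of the median can be empty, so [m] lies between two values of
    cover functions, both within 1 of [a]. *)
Lemma weighted_median_dist (w : (X -> R) -> R) (x : X) (m a : R) :
  (forall f, f \in N -> `|f x - a| <= 1) -> weighted_median N w x m -> `|m - a| <= 1.
Proof.
move=> Na [up down].
have ex (A : pred (X -> R)) : 2^-1 <= \sum_(f <- N | A f) w f ->
    exists2 f, f \in N & A f.
  move=> le2; have [/hasP[f fN Af]|/hasPn nA] := boolP (has A N); first by exists f.
  by move: le2; rewrite big_seq_cond big1 => [|f /andP[/nA/negbTE->]//]; lra.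
have [f fN mf] := ex _ up; have [g gN gm] := ex _ down.
have := Na f fN; have := Na g gN; rewrite !ler_norml.
by move=> /andP[? ?] /andP[? ?]; apply/andP; split; lra.
Qed.

(** A guess strictly between [f0 (x t)] and the median separates [f0] from every function at or
    beyond the median, and these carry at least half of the weight. *)
Lemma opposed_mass_median (p' : R) (x : nat -> X) (y sigma : nat -> R) f0 t m :
  0 < p' -> p' < 2^-1 -> (0 < #|` N|)%N ->
  weighted_median N (weights N p' x y sigma t) (x t) m ->
  (f0 (x t) < y t) && (y t < m) || (m < y t) && (y t < f0 (x t)) ->
  2^-1 <= opposed_mass N p' x y sigma f0 t.
Proof.
move=> p'0 p'2 N0 [up down] yb.
rewrite /opposed_mass; case/orP: yb => /andP[h1 h2].
- apply: le_trans up _; rewrite big_mkcond/=; apply: ler_sum => f _.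
  case: ifPn => mf; last by rewrite mulr_ge0// ltW// weights_gt0.
  by rewrite h1 (lt_le_trans h2 mf)/= mulr1.
- apply: le_trans down _; rewrite big_mkcond/=; apply: ler_sum => f _.
  case: ifPn => mf; last by rewrite mulr_ge0// ltW// weights_gt0.
  by rewrite h2 (le_lt_trans mf h1)/= orbT mulr1.
Qed.

End Median.

(** * Independence and measurability *)

Section Uniform.
Context {R : realType} (a b : R) (ab : a < b).

Lemma uniform_prob_le (B : set R) : measurable B ->
  (uniform_prob ab B <= ((b - a)^-1)%:E * lebesgue_measure B)%E.
Proof.
move=> mB; rewrite -integral_cst//; apply: ge0_le_integral => //.
- by move=> x _; rewrite lee_fin uniform_pdf_ge0.
- by apply/measurable_EFinP; apply: measurable_funTS; exact: measurable_uniform_pdf.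
- move=> x _; rewrite lee_fin /uniform_pdf; case: ifP => // _.
  by rewrite invr_ge0 subr_ge0 ltW.
Qed.

Lemma uniform_probE (B : set R) : measurable B -> B `<=` `[a, b] ->
  uniform_prob ab B = (((b - a)^-1)%:E * lebesgue_measure B)%E.
Proof.
move=> mB Bab; rewrite -integral_cst//; apply: eq_integral => x; rewrite inE => /Bab.
by rewrite /= in_itv/= /uniform_pdf => ->.
Qed.

End Uniform.

Section MeasurableWrt.
Context {d : measure_display} {T : measurableType d} {d' : measure_display}
  {Y : measurableType d'}.

Lemma measurable_wrt_generated (F G : set (set T)) (Z : T -> Y) :
  F `<=` <<s G >> -> measurable_wrt F Z ->
  measurable_fun setT (Z : g_sigma_algebraType G -> Y).
Proof. by move=> FG mZ _ B mB; rewrite setTI; apply: FG; exact: mZ. Qed.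

Lemma measurable_wrt_measurable (F : set (set T)) (Z : T -> Y) :
  F `<=` measurable -> measurable_wrt F Z -> measurable_fun setT Z.
Proof. by move=> Fm mZ _ B mB; rewrite setTI; apply: Fm; exact: mZ. Qed.

End MeasurableWrt.

Section Independence.
Context {d : measure_display} {T : measurableType d} {R : realType}.

Lemma integral_mrestr (mu : measure T R) (E : set T) (mE : measurable E)
    (f : T -> \bar R) : measurable_fun setT f -> (forall w, 0 <= f w)%E ->
  (\int[mrestr mu mE]_w f w = \int[mu]_(w in E) f w)%E.
Proof.
move=> mf f0.
have mC := measurableC mE.
have C0 : mrestr mu mE (~` E) = 0%E by rewrite /mrestr setICl measure0.
rewrite (ge0_negligible_integral mC measurableT mf (fun w _ => f0 w) C0).
rewrite setTD setCK.
apply: eq_measure_integral => A mA AE.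
by rewrite /= /mrestr setIidl.
Qed.

(** [P] restricted to [E] and [c] times [P] agree on the pi-system [G], hence on the sigma-algebra
    it generates. They therefore give the same integral to any nonnegative [Z] measurable for that
    sigma-algebra. *)
Lemma indep_integral (P : probability T R) (G : set (set T)) (E : set T) (c : {nonneg R})
    (Z : T -> R) : G `<=` measurable -> setI_closed G -> G setT -> measurable E ->
  (forall A, G A -> P (A `&` E) = (c%:num%:E * P A)%E) ->
  measurable_fun setT (Z : g_sigma_algebraType G -> R) -> (forall w, 0 <= Z w) ->
  (\int[P]_w (Z w * \1_E w)%:E = c%:num%:E * \int[P]_w (Z w)%:E)%E.
Proof.
move=> Gm GI GT mE indep mZ Z0.
have sGm : <<s G >> `<=` measurable.
  by apply: smallest_sub => //; exact: sigma_algebra_measurable.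
have mid : measurable_fun setT (id : T -> g_sigma_algebraType G).
  by move=> _ B mB; rewrite setTI; exact: sGm.
have mZT : measurable_fun setT Z.
  by move=> _ B mB; rewrite setTI; apply: sGm; rewrite -[X in <<s _ >> X]setTI; exact: mZ.
have mZE : measurable_fun setT (EFin \o Z : g_sigma_algebraType G -> \bar R).
  exact/measurable_EFinP.
have mZTE : measurable_fun setT (EFin \o Z) by exact/measurable_EFinP.
have eqm A : <<s G >> A -> mrestr P mE A = mscale c P A.
  apply: (@g_sigma_algebra_measure_unique _ _ _ G Gm (fun=> setT)) => //.
  - by rewrite bigcup_const//; exists 0%N.
  - move=> k; rewrite /= /mrestr setTI.
    by apply: le_lt_trans (probability_le1 P mE) _; exact: ltry.
have -> : (\int[P]_w (Z w * \1_E w)%:E = \int[P]_(w in E) (Z w)%:E)%E.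
  rewrite [RHS]integral_mkcond; apply: eq_integral => w _.
  by rewrite patchE indicE; case: ifP => _; rewrite ?mulr1 ?mulr0.
rewrite -(@integral_mrestr P _ mE)//.
rewrite -ge0_integral_mscale//; last by move=> w _; rewrite lee_fin.
(* Pushing forward along the identity to the coarser sigma-algebra leaves an integral that depends
   only on the measures of its sets. *)
have pf (mu : measure T R) : (\int[mu]_w (Z w)%:E =
    \int[pushforward mu (id : T -> g_sigma_algebraType G)]_w (Z w)%:E)%E.
  by rewrite (ge0_integral_pushforward mid)//; move=> w _; rewrite lee_fin.
rewrite [LHS]pf [RHS]pf.
by apply: eq_measure_integral => A mA _; exact: (eqm A mA).
Qed.

(** By independence the law of [(V, U)] is the product of the marginals. Integrating over [V] first
    fixes the value [v], and each section is an interval covered by the last hypothesis. *)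
Lemma indep_near_le (P : probability T R) (V U : T -> R)
    (c eps : R) : measurable_fun setT V -> measurable_fun setT U ->
  (forall A B, measurable A -> measurable B ->
    P (V @^-1` A `&` U @^-1` B) = (P (V @^-1` A) * P (U @^-1` B))%E) ->
  (forall v : R, (P (U @^-1` `[(v - eps)%R, (v + eps)%R]%classic) <= c%:E)%E) ->
  (P [set w | (`|U w - V w| <= eps)%R] <= c%:E)%E.
Proof.
move=> mV mU indep Uc.
pose X : set (R * R) := [set vu | `|vu.2 - vu.1| <= eps].
have mX : measurable X.
  rewrite -[X]setTI.
  have mn : measurable_fun setT (fun vu : R * R => `|vu.2 - vu.1|).
    apply: (@measurableT_comp _ _ _ _ _ _ (@Num.norm R R)) => //.
    by apply: measurable_funB.
  have := mn measurableT `]-oo, eps]%classic (measurable_itv _).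
  by congr (measurable (_ `&` _)); apply/seteqP; split=> z /=; rewrite in_itv.
have mVU : measurable_fun setT (fun w => (V w, U w)) by exact/measurable_fun_pair.
pose PV := distribution P (mfun_Sub (mem_set mV)).
pose PU := distribution P (mfun_Sub (mem_set mU)).
have -> : P [set w | `|U w - V w| <= eps] = pushforward P (fun w => (V w, U w)) X by [].
rewrite -(@product_measure_unique _ _ _ _ _ PV PU (pushforward P (fun w => (V w, U w))))//.
rewrite /product_measure1.
apply: (@le_trans _ _ (\int[PV]_x (cst c%:E x))%E); last first.
  have PV1 : PV setT = 1%E := probability_setT P.
  by rewrite integral_cst//= [X in (_ * X)%E]PV1 mule1.
apply: ge0_le_integral => //.
- exact: measurable_fun_xsection.
- move=> v _ /=; rewrite (_ : xsection X v = `[v - eps, v + eps]%classic) ?Uc//.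
  by apply/seteqP; split=> u; rewrite xsectionP /X/= in_itv/= ler_norml => /andP[? ?];
    apply/andP; split; lra.
Qed.

End Independence.

(** * Measurability of the weights and of the quantities of a round *)

Section MeasurableWeights.
Context {R : realType} {X : Type} (N : {fset (X -> R)}) (p' : R).
Hypotheses (p'_gt0 : 0 < p') (p'_lt2 : p' < 2^-1) (N_gt0 : (0 < #|` N|)%N).
Context {d : measure_display} {S : measurableType d}.
Variables (x : nat -> S -> X) (y sigma : nat -> S -> R).

Lemma measurable_fun_inv (g : S -> R) : measurable_fun setT g ->
  (forall w, 0 < g w) -> measurable_fun setT (fun w => (g w)^-1).
Proof.
move=> mg g0.
rewrite (_ : (fun _ => _) = (fun w => expR (- ln (g w)))).
  apply: measurableT_comp => //; apply: measurable_funN.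
  exact: measurableT_comp.
by apply/funext => w; rewrite expRN lnK ?posrE.
Qed.

Lemma measurable_fun_fsum (h : (X -> R) -> S -> R) :
  (forall f, f \in N -> measurable_fun setT (h f)) ->
  measurable_fun setT (fun w => \sum_(f <- N) h f w).
Proof.
move=> mh; under eq_fun do rewrite big_tnth.
by apply: measurable_sum => i; apply: mh; exact: mem_tnth.
Qed.

Lemma measurable_fun_natr (b : S -> bool) : measurable_fun setT b ->
  measurable_fun setT (fun w => (b w)%:R : R).
Proof.
move=> mb.
rewrite (_ : (fun _ => _) = (fun w => if b w then 1 else 0 : R)).
  exact: measurable_fun_ifT.
by apply/funext => w; case: (b w).
Qed.

(** The space [S] is arbitrary because the results of this section are applied to [Omega] with the
    sigma-algebra of the past and the current guess, coarser than its own. *)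
Lemma measurable_weights t :
  (forall s f, (s < t)%N -> f \in N -> measurable_fun setT (fun w => f (x s w))) ->
  (forall s, (s < t)%N -> measurable_fun setT (y s)) ->
  (forall s, (s < t)%N -> measurable_fun setT (sigma s)) ->
  forall f, f \in N ->
  measurable_fun setT (fun w => weights N p' (x^~ w) (y^~ w) (sigma^~ w) t f).
Proof.
elim: t => [|t IH] mx my ms f fN; first exact: measurable_cst.
have {}IH g : g \in N ->
    measurable_fun setT (fun w => weights N p' (x^~ w) (y^~ w) (sigma^~ w) t g).
  apply: IH => [s h st|s st|s st]; [apply: mx|apply: my|apply: ms]; exact: ltnW.
have mwhat g : g \in N -> measurable_fun setT (fun w =>
    factor p' (x^~ w) (y^~ w) (sigma^~ w) t g *
    weights N p' (x^~ w) (y^~ w) (sigma^~ w) t g).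
  move=> gN; apply: measurable_funM; last exact: IH.
  apply: measurable_fun_ifT => //; apply: measurable_fun_ltr => //.
  apply: measurable_funM; first exact: ms.
  by apply: measurable_funB; [exact: my|exact: mx].
under eq_fun do rewrite weightsS.
apply: measurable_funM; first exact: mwhat.
apply: measurable_fun_inv => [|w]; last exact: factor_sum_gt0.
exact: measurable_fun_fsum.
Qed.

Section Round.
Variables (t : nat) (f0 : X -> R) (eps : R).
Hypotheses
 (mx : forall s f, (s <= t)%N -> f \in N -> measurable_fun setT (fun w => f (x s w)))
 (mf0 : measurable_fun setT (fun w => f0 (x t w)))
 (my : forall s, (s <= t)%N -> measurable_fun setT (y s))
 (ms : forall s, (s < t)%N -> measurable_fun setT (sigma s)).

(** Guesses enter up to round [t], but feedback only from earlier rounds. This is what later makes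
    the opposed mass independent of the flip of round [t]. *)
Lemma measurable_opposed_mass : measurable_fun setT (fun w =>
  opposed_mass N p' (x^~ w) (y^~ w) (sigma^~ w) f0 t).
Proof.
apply: measurable_fun_fsum => f fN; apply: measurable_funM.
  apply: measurable_weights fN => [s g st|s st|s st].
  - exact/mx/ltnW.
  - exact/my/ltnW.
  - exact: ms.
apply: measurable_fun_natr; apply: measurable_or; apply: measurable_and;
  apply: measurable_fun_ltr => //; by [exact: mx|exact: my].
Qed.

Lemma measurable_bad_guess : measurable_fun setT (fun w =>
  bad_guess N (x^~ w) (y^~ w) f0 eps t).
Proof.
apply: measurable_or.
  apply: measurable_fun_ler => //; apply: (@measurableT_comp _ _ _ _ _ _ (@Num.norm R R)) => //.
  by apply: measurable_funB => //; exact: my.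
have mxt f : f \in enum_fset N -> measurable_fun setT (fun w => f (x t w)) by exact: mx.
elim: (enum_fset N) mxt => [|f s IH] ms'; first exact: measurable_cst.
apply: measurable_or.
  by apply: measurable_fun_eqr; [exact: my|apply: ms'; rewrite mem_head].
by apply: IH => g gs; apply: ms'; rewrite in_cons gs orbT.
Qed.

End Round.
End MeasurableWeights.

(** * Expectations of bounded random variables *)

Section BoundedMeasurable.
Context {d : measure_display} {T : measurableType d} {R : realType}
  (P : probability T R).
Implicit Types f g : T -> R.

(** This class is closed under sums and products and consists of integrable functions, so the
    real-valued [mean] is linear and monotone on it. *)
Definition bounded_measurable f :=
  measurable_fun setT f /\ exists M, forall w, `|f w| <= M.

Lemma bounded_measurable_integrable f :
  bounded_measurable f -> P.-integrable setT (EFin \o f).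
Proof.
move=> [mf [M fM]]; apply: measurable_bounded_integrable => //.
  by apply: le_lt_trans (probability_le1 P measurableT) _; exact: ltry.
exists M; split; first exact: num_real.
by move=> A MA w _; apply: le_trans (fM w) _; exact: ltW.
Qed.

Lemma bounded_measurable_cst (c : R) : bounded_measurable (fun=> c).
Proof. by split; [exact: measurable_cst|exists `|c|]. Qed.

Lemma bounded_measurableD f g : bounded_measurable f -> bounded_measurable g ->
  bounded_measurable (fun w => f w + g w).
Proof.
move=> [mf [M fM]] [mg [M' gM]]; split; first exact: measurable_funD.
by exists (M + M') => w; rewrite (le_trans (ler_normD _ _))// lerD.
Qed.

Lemma bounded_measurableM f g : bounded_measurable f -> bounded_measurable g ->
  bounded_measurable (fun w => f w * g w).
Proof.
move=> [mf [M fM]] [mg [M' gM]]; split; first exact: measurable_funM.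
by exists (M * M') => w; rewrite normrM ler_pM.
Qed.

Lemma bounded_measurableZ (c : R) f : bounded_measurable f ->
  bounded_measurable (fun w => c * f w).
Proof. by move=> bf; apply: bounded_measurableM => //; exact: bounded_measurable_cst. Qed.

Lemma bounded_measurable_natr (b : T -> bool) : measurable_fun setT b ->
  bounded_measurable (fun w => (b w)%:R).
Proof.
move=> mb; split; first exact: measurable_fun_natr.
by exists 1 => w; case: (b w); rewrite /= ?normr0 ?normr1.
Qed.

Lemma bounded_measurable_sum n (h : 'I_n -> T -> R) :
  (forall i, bounded_measurable (h i)) ->
  bounded_measurable (fun w => \sum_(i < n) h i w).
Proof.
elim: n h => [|n IH] h bh.
  under eq_fun do rewrite big_ord0; exact: bounded_measurable_cst.
by under eq_fun do rewrite big_ord_recr; apply: bounded_measurableD => //; exact: IH.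
Qed.

Definition mean f : R := \int[P]_w f w.

Lemma meanD f g : bounded_measurable f -> bounded_measurable g ->
  mean (fun w => f w + g w) = mean f + mean g.
Proof. by move=> bf bg; apply: RintegralD => //; exact: bounded_measurable_integrable. Qed.

Lemma meanZ (c : R) f : bounded_measurable f -> mean (fun w => c * f w) = c * mean f.
Proof. by move=> bf; apply: RintegralZl => //; exact: bounded_measurable_integrable. Qed.

Lemma mean_cst (c : R) : mean (fun=> c) = c.
Proof. by rewrite /mean Rintegral_cst// (_ : fine _ = 1) ?mulr1//= probability_setT. Qed.

Lemma mean_sum n (h : 'I_n -> T -> R) : (forall i, bounded_measurable (h i)) ->
  mean (fun w => \sum_(i < n) h i w) = \sum_(i < n) mean (h i).
Proof.
elim: n h => [|n IH] h bh.
  by under [X in mean X]eq_fun do rewrite big_ord0; rewrite big_ord0 mean_cst.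
under [X in mean X]eq_fun do rewrite big_ord_recr.
rewrite meanD//; first by rewrite IH// big_ord_recr.
exact: bounded_measurable_sum.
Qed.

Lemma le_mean f g : bounded_measurable f -> bounded_measurable g ->
  (forall w, f w <= g w) -> mean f <= mean g.
Proof.
by move=> bf bg fg; apply: le_Rintegral => //; exact: bounded_measurable_integrable.
Qed.

Lemma mean_EFin f : bounded_measurable f -> (\int[P]_w (f w)%:E = (mean f)%:E)%E.
Proof.
move=> bf; rewrite fineK//.
by apply: integrable_fin_num => //; exact: bounded_measurable_integrable.
Qed.

Lemma mean_natr (b : T -> bool) : measurable_fun setT b ->
  (mean (fun w => (b w)%:R))%:E = P [set w | b w].
Proof.
move=> mb; rewrite -mean_EFin; last exact: bounded_measurable_natr.
have mB : measurable [set w | b w].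
  by rewrite -[X in measurable X]setTI; exact: (mb measurableT [set true]).
rewrite -[in RHS](setIT [set w | b w]) -integral_indic//.
apply: eq_integral => w _; rewrite indicE (_ : (w \in _) = b w)//.
by apply/idP/idP; rewrite inE.
Qed.

End BoundedMeasurable.

(** * Rounds of the algorithm *)

Section Gain.
Context {R : realType} (p p' : R).

(** The second factor is the expectation of [progress] under a Bernoulli(p) flip. It is positive
    because [p < p'] makes the first quotient exceed 1 and the second stay below 1. *)
Definition gain : R := (1 - 2 * p') * ((1 - p) / (1 - p') - p / p').

Lemma gain_gt0 : 0 <= p -> p < p' -> p' < 2^-1 -> 0 < gain.
Proof.
move=> p0 pp' p'2; rewrite /gain mulr_gt0//; first by lra.
rewrite subr_gt0; apply: (@lt_trans _ _ 1).
  by rewrite ltr_pdivrMr ?mul1r//; lra.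
by rewrite ltr_pdivlMr ?mul1r; lra.
Qed.

End Gain.

Section Analysis.
Context {R : realType} (p p' : R) {X : Type} (H : set (X -> R)) (f0 : X -> R)
  (T : nat) (T_gt0 : (0 < T)%N) (N : {fset (X -> R)})
  {disp : measure_display} {Omega : measurableType disp} (P : probability Omega R)
  (F : nat -> set (set Omega)) (x : nat -> Omega -> X)
  (m y sigma : nat -> Omega -> R) (flip : nat -> Omega -> bool).
Hypotheses (p_ge0 : 0 <= p) (ltpp' : p < p') (p'_lt2 : p' < 2^-1).
Hypothesis loss_le1 : forall f g z, H f -> H g -> `|f z - g z| <= 1.
Hypotheses (Hf0 : H f0) (NH : is_cover (T%:R ^+ 2)^-1 H N).
Hypothesis Hfeedback : noisy_feedback P H f0 p T F x y flip sigma.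
Hypothesis Halg : median_algorithm P N p' T_gt0 F x m y sigma.

Let eps : R := (T%:R ^+ 2)^-1.

Let p'_gt0 : 0 < p'. Proof. exact: le_lt_trans ltpp'. Qed.
Let N_gt0 : (0 < #|` N|)%N. Proof. exact: is_cover_card_gt0 NH Hf0. Qed.
Let T0 : 0 < T%:R :> R. Proof. by rewrite ltr0n. Qed.

Lemma filtration_sub s t : (s <= t)%N -> F s `<=` F t.
Proof.
case: (nf_filtration Hfeedback) => _ _ FS; elim: t => [|t IH]; first by rewrite leqn0 => /eqP->.
by rewrite leq_eqVlt => /predU1P[->//|/IH st]; exact: subset_trans (FS t).
Qed.

Let F_measurable t : F t `<=` measurable.
Proof. by case: (nf_filtration Hfeedback). Qed.

Let F_setT t : F t setT.
Proof.
by case: (nf_filtration Hfeedback) => /(_ t)[F0 FC _] _ _; rewrite -(setD0 setT); exact: FC.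
Qed.

Let F_setI t A B : F t A -> F t B -> F t (A `&` B).
Proof.
case: (nf_filtration Hfeedback) => /(_ t) sF _ _ FA FB.
rewrite -[X in X _](sigma_algebra_id sF).
by apply: (@measurableI _ (g_sigma_algebraType (F t))); exact: sub_sigma_algebra.
Qed.

(** A pi-system generating what is known just before the flip of round [t]. The flip law is stated
    on exactly these events. *)
Definition guess_rectangles (t : nat) : set (set Omega) :=
  [set A `&` y t @^-1` B | A in F t & B in measurable].

Section Round.
Variables (t : nat) (tT : (t < T)%N).
Let G := guess_rectangles t.

Let mFR (Z : Omega -> R) : measurable_wrt (F t) Z -> measurable_fun setT Z.
Proof. exact: measurable_wrt_measurable (@F_measurable t). Qed.

Lemma measurable_guess : measurable_fun setT (y t).
Proof. exact: measurable_wrt_measurable (@F_measurable t.+1) (nf_guess Hfeedback tT). Qed.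

Lemma guess_rectangles_measurable : G `<=` measurable.
Proof.
move=> _ [A FA [B mB <-]]; apply: measurableI; first exact: F_measurable FA.
by rewrite -[X in measurable X]setTI; exact: measurable_guess.
Qed.

Lemma guess_rectangles_setI : setI_closed G.
Proof.
move=> _ _ [A FA [B mB <-]] [A' FA' [B' mB' <-]].
exists (A `&` A'); first exact: F_setI.
by exists (B `&` B'); [exact: measurableI|rewrite preimage_setI setIACA].
Qed.

Lemma guess_rectangles_setT : G setT.
Proof. by exists setT => //; exists setT => //; rewrite preimage_setT setIT. Qed.

Let F_sub_G : F t `<=` <<s G >>.
Proof.
move=> A FA; apply: sub_sigma_algebra.
by exists A => //; exists setT => //; rewrite preimage_setT setIT.
Qed.

Let measurable_of_G d' (Y : measurableType d') (Z : Omega -> Y) :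
  measurable_fun setT (Z : g_sigma_algebraType G -> Y) -> measurable_fun setT Z.
Proof.
move=> mZ _ B mB; rewrite setTI.
have sGm : <<s G >> `<=` measurable.
  by apply: smallest_sub; [exact: sigma_algebra_measurable|exact: guess_rectangles_measurable].
by apply: sGm; rewrite -[X in <<s _ >> X]setTI; exact: mZ.
Qed.

Definition bad w : bool := bad_guess N (x^~ w) (y^~ w) f0 eps t.

Definition opposed w : R := opposed_mass N p' (x^~ w) (y^~ w) (sigma^~ w) f0 t.

Definition good_mass w : R := (~~ bad w)%:R * opposed w.

Let mGx s f : (s <= t)%N -> H f ->
  measurable_fun setT ((fun w => f (x s w)) : g_sigma_algebraType G -> R).
Proof.
move=> st Hf; apply: (@measurable_wrt_generated _ _ _ _ (F s)).
  exact: subset_trans (filtration_sub _ _ st) F_sub_G.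
exact: (nf_context Hfeedback (leq_ltn_trans st tT) Hf).
Qed.

Let mGy s : (s <= t)%N -> measurable_fun setT (y s : g_sigma_algebraType G -> R).
Proof.
rewrite leq_eqVlt => /predU1P[->|st].
  move=> _ B mB; rewrite setTI; apply: sub_sigma_algebra.
  by exists setT => //; exists B => //; rewrite setTI.
apply: (@measurable_wrt_generated _ _ _ _ (F s.+1)).
  exact: subset_trans (filtration_sub _ _ st) F_sub_G.
exact: (nf_guess Hfeedback (ltn_trans st tT)).
Qed.

Let mGs s : (s < t)%N -> measurable_fun setT (sigma s : g_sigma_algebraType G -> R).
Proof.
move=> st; apply: (@measurable_wrt_generated _ _ _ _ (F s.+1)).
  exact: subset_trans (filtration_sub _ _ st) F_sub_G.
exact: (nf_sigma Hfeedback (ltn_trans st tT)).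
Qed.

Let mGbad : measurable_fun setT (bad : g_sigma_algebraType G -> bool).
Proof.
apply: measurable_bad_guess => [s f st fN||s st].
- by apply: mGx => //; case: NH => NHf _; exact: NHf.
- exact: mGx.
- exact: mGy.
Qed.

Let mGgood : measurable_fun setT (good_mass : g_sigma_algebraType G -> R).
Proof.
apply: measurable_funM.
  by apply: measurable_fun_natr; exact: measurable_neg.
apply: measurable_opposed_mass => // [s f st fN|].
- by apply: mGx => //; case: NH => NHf _; exact: NHf.
- exact: mGx.
Qed.

Lemma measurable_bad : measurable_fun setT bad.
Proof. exact: measurable_of_G mGbad. Qed.

Lemma good_mass_bounds w : 0 <= good_mass w <= 1.
Proof.
rewrite /good_mass; have o0 : 0 <= opposed w by exact: opposed_mass_ge0.
have o1 : opposed w <= 1 by exact: opposed_mass_le1.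
by case: (bad w); rewrite /= ?mul0r ?mul1r ?lexx ?ler01 ?o0.
Qed.

Lemma bounded_good_mass : bounded_measurable good_mass.
Proof.
split; first exact: measurable_of_G mGgood.
by exists 1 => w; case/andP: (good_mass_bounds w) => z0 z1; rewrite ger0_norm.
Qed.

Lemma measurable_flip : measurable_fun setT (flip t).
Proof. exact: measurable_wrt_measurable (@F_measurable t.+1) (nf_flip Hfeedback tT). Qed.

(** [good_mass] is determined by the past and the current guess, and the flip is independent of
    both. *)
Lemma mean_good_mass_flip :
  mean P (fun w => good_mass w * (flip t w)%:R) = p * mean P good_mass.
Proof.
have bz := bounded_good_mass.
apply: EFin_inj; rewrite EFinM -!mean_EFin//; last first.
  by apply: bounded_measurableM => //; apply: bounded_measurable_natr; exact: measurable_flip.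
pose E := flip t @^-1` [set true].
have mE : measurable E.
  by rewrite -[X in measurable X]setTI; exact: (measurable_flip measurableT [set true]).
have p1 : 0 <= p <= 1 by move: p_ge0 ltpp' p'_lt2 => ? ? ?; apply/andP; split; lra.
rewrite -(@indep_integral _ _ _ P G E (NngNum p_ge0))//.
- apply: eq_integral => w _; rewrite indicE (_ : (w \in E) = flip t w)//.
  by apply/idP/idP; rewrite inE.
- exact: guess_rectangles_measurable.
- exact: guess_rectangles_setI.
- exact: guess_rectangles_setT.
- move=> _ [A FA [B mB <-]]; rewrite (nf_flip_law Hfeedback)// muleC bernoulli_probE//.
  by rewrite !diracE mem_set// memNset//= mule1 mule0 adde0.
- by move=> w; case/andP: (good_mass_bounds w).
Qed.

Let mm : measurable_fun setT (m t).
Proof. exact: mFR (ma_adapted Halg tT). Qed.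

Let mx f : H f -> measurable_fun setT (fun w => f (x t w)).
Proof. by move=> Hf; exact: mFR (nf_context Hfeedback tT Hf). Qed.

(** Centred at the median, the guess becomes a variable uniform on [[-1/T, 1/T]] and independent of
    [F t]. *)
Let U w := y t w - m t w.

Let mU : measurable_fun setT U.
Proof. by apply: measurable_funB; [exact: measurable_guess|exact: mm]. Qed.

Let offset_law (B : set R) : measurable B ->
  P (U @^-1` B) = uniform_prob (@oppV_lt_V R T T_gt0) B.
Proof.
by move=> mB; rewrite -[X in P X = _]setTI (ma_guess_law Halg tT)// probability_setT mul1e.
Qed.

Let measurable_wrtB (f : X -> R) : H f ->
  measurable_wrt (F t) (fun w => f (x t w) - m t w).
Proof.
move=> Hf B mB; rewrite -[X in F t X]setTI.
case: (nf_filtration Hfeedback) => /(_ t) sF _ _.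
have FF : F t `<=` <<s F t >> by exact: sub_sigma_algebra.
rewrite -[X in X _](sigma_algebra_id sF).
apply: (measurable_funB (measurable_wrt_generated _ _ _ FF (nf_context Hfeedback tT Hf))
  (measurable_wrt_generated _ _ _ FF (ma_adapted Halg tT))) => //.
Qed.

(** After centring at the median, [f] contributes an [F t]-measurable variable. The uniform offset,
    of density [T / 2], falls in a given interval of length [2 * e] with probability at most
    [e * T]. *)
Lemma guess_near_le (f : X -> R) (e : R) : H f -> 0 <= e ->
  (P [set w | (`|y t w - f (x t w)| <= e)%R] <= (e * T%:R)%:E)%E.
Proof.
move=> Hf e0; pose V w := f (x t w) - m t w.
have -> : [set w | (`|y t w - f (x t w)| <= e)%R] = [set w | (`|U w - V w| <= e)%R].
  by apply/funext => w /=; rewrite /U /V opprB addrA subrK.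
apply: (@indep_near_le _ _ _ P V U (e * T%:R) e) => //.
- by apply: measurable_funB; [exact: mx|exact: mm].
- move=> A B mA mB; rewrite offset_law//.
  by apply: (ma_guess_law Halg tT) => //; exact: measurable_wrtB.
- move=> v; rewrite offset_law//; apply: le_trans (uniform_prob_le _ _ _ _ _) _.
    exact: measurable_itv.
  rewrite lebesgue_measure_itv/= lte_fin.
  case: ifP => _; last by rewrite mule0 lee_fin mulr_ge0// ltW.
  rewrite -EFinB -EFinM lee_fin le_eqVlt; apply/orP; left; apply/eqP.
  by field; rewrite gt_eqF.
Qed.

Lemma mean_bad_le : mean P (fun w => (bad w)%:R) <= T%:R^-1.
Proof.
rewrite -lee_fin mean_natr; last exact: measurable_bad.
have mnear (f : X -> R) (e : R) : H f -> measurable [set w | (`|y t w - f (x t w)| <= e)%R].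
  move=> Hf; rewrite -[X in measurable X]setTI.
  have : measurable_fun setT (fun w => `|y t w - f (x t w)| <= e).
    apply: measurable_fun_ler => //; apply: (@measurableT_comp _ _ _ _ _ _ (@Num.norm R R)) => //.
    by apply: measurable_funB; [exact: measurable_guess|exact: mx].
  by move=> /(_ measurableT [set true] I).
have NHf f : f \in N -> H f by case: NH => + _; exact.
(* Ties are near misses of radius 0, hence null events. Being near [f0] has probability at most
   [eps * T], which is [1 / T]. *)
pose tie := \big[setU/set0]_(f <- N) [set w | (`|y t w - f (x t w)| <= 0)%R].
have tie0 : measurable tie /\ P tie = 0%E.
  rewrite /tie; have : {in enum_fset N, forall f, H f} by exact: NHf.
  elim: (enum_fset N) => [|f s IH] sH.
    by rewrite big_nil; split; [exact: measurable0|exact: measure0].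
  rewrite big_cons.
  have [ms Ps] := IH (fun g gs => sH g (@mem_behead _ (f :: s) g gs)).
  have Hf : H f by apply: sH; exact: mem_head.
  split; first by apply: measurableU => //; exact: mnear.
  apply/eqP; rewrite eq_le measure_ge0 andbT.
  apply: le_trans (measureU2 _ _ _) _ => //; first exact: mnear.
  rewrite [X in (_ + X <= _)%E]Ps adde0.
  by apply: le_trans (guess_near_le f 0 Hf _) _ => //; rewrite mul0r.
apply: (@le_trans _ _ (P ([set w | (`|y t w - f0 (x t w)| <= eps)%R] `|` tie))).
  apply: le_measure; rewrite ?inE.
  - by rewrite -[X in measurable X]setTI; exact: (measurable_bad measurableT [set true]).
  - by apply: measurableU; [exact: mnear|exact: tie0.1].
  - move=> w /orP[near|/hasP[f fN /eqP yf]]; [by left|right].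
    rewrite /tie -bigcup_seq; exists f => //=.
    by rewrite yf subrr normr0.
apply: le_trans (measureU2 _ _ _) _; [exact: mnear|exact: tie0.1|].
rewrite [X in (_ + X <= _)%E]tie0.2 adde0; apply: le_trans (guess_near_le f0 eps Hf0 _) _.
  by rewrite /eps invr_ge0 exprn_ge0.
by rewrite lee_fin /eps expr2 invfM -mulrA mulVf ?mulr1// gt_eqF.
Qed.

(** The two sides are kept apart because the half of the offsets that moves the guess towards [f0]
    depends on the side. *)
Definition above_far w : bool := 2 / T%:R < m t w - f0 (x t w).

Definition below_far w : bool := 2 / T%:R < f0 (x t w) - m t w.

Lemma measurable_above_far : measurable_fun setT above_far.
Proof. by apply: measurable_fun_ltr => //; apply: measurable_funB; [exact: mm|exact: mx]. Qed.

Lemma measurable_below_far : measurable_fun setT below_far.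
Proof. by apply: measurable_fun_ltr => //; apply: measurable_funB; [exact: mx|exact: mm]. Qed.

Lemma uniform_half (i : interval R) : [set` i] `<=` `[(- T%:R^-1 : R), T%:R^-1] ->
  lebesgue_measure ([set` i] : set R) = (T%:R^-1)%:E ->
  uniform_prob (@oppV_lt_V R T T_gt0) [set` i] = (2^-1)%:E.
Proof.
move=> iT li; rewrite uniform_probE//.
rewrite [X in (_ * X)%E]li -EFinM; congr EFin.
by field; rewrite gt_eqF.
Qed.

Let mean_half (A : Omega -> bool) (i : interval R) :
  F t [set w | A w] -> measurable_fun setT A ->
  uniform_prob (@oppV_lt_V R T T_gt0) [set` i] = (2^-1)%:E ->
  mean P (fun w => (A w && (U w \in i))%:R) = mean P (fun w => (A w)%:R) / 2.
Proof.
move=> FA mA ui; apply: EFin_inj.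
have mUi : measurable_fun setT (fun w => U w \in i).
  apply: (measurable_fun_bool true) => //.
  exact: (mU measurableT [set` i] (measurable_itv _)).
rewrite EFinM !mean_natr//; last exact: measurable_and.
rewrite -ui -(ma_guess_law Halg tT)//.
by congr (P _); apply/seteqP; split=> w /=; [case/andP|case=> ? ?; apply/andP].
Qed.

(** A far median is known before the guess, so with conditional probability one half the guess falls
    strictly between it and [f0]. Such a guess satisfies [1 <= 2 * good_mass + bad]; undoing the
    factor one half doubles both coefficients. *)
Lemma mean_far_le : mean P (fun w => (above_far w)%:R) + mean P (fun w => (below_far w)%:R)
  <= 4 * mean P good_mass + 2 * mean P (fun w => (bad w)%:R).
Proof.
have TV0 : 0 < T%:R^-1 :> R by rewrite invr_gt0.
(* Excluding the offset 0 makes the guess strictly different from the median, at no cost in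
   probability. *)
pose I1 : interval R := `[- T%:R^-1, 0[; pose I2 : interval R := `]0, T%:R^-1].
have u1 : uniform_prob (@oppV_lt_V R T T_gt0) [set` I1] = (2^-1)%:E.
  apply: uniform_half.
    by move=> z; rewrite /= !in_itv/= => /andP[? ?]; apply/andP; split; lra.
  by rewrite lebesgue_measure_itv/= lte_fin oppr_lt0 TV0 -EFinD sub0r opprK.
have u2 : uniform_prob (@oppV_lt_V R T T_gt0) [set` I2] = (2^-1)%:E.
  apply: uniform_half.
    by move=> z; rewrite /= !in_itv/= => /andP[? ?]; apply/andP; split; lra.
  by rewrite lebesgue_measure_itv/= lte_fin TV0 -EFinD subr0.
have Ffar (h : Omega -> R) : measurable_wrt (F t) h -> F t [set w | 2 / T%:R < h w].
  move=> mh; have := mh `]2 / T%:R, +oo[%classic (measurable_itv _).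
  by congr (F t _); apply/seteqP; split=> w /=; rewrite in_itv/= andbT.
have Fabove : F t [set w | above_far w].
  have mB : measurable (-%R @^-1` `]2 / T%:R, +oo[%classic : set R).
    rewrite -[X in measurable X]setTI.
    by apply: (@oppr_measurable R setT) => //; exact: measurable_itv.
  have := measurable_wrtB f0 Hf0 _ mB.
  by congr (F t _); apply/seteqP; split=> w /=; rewrite in_itv/= andbT opprB.
have Fbelow : F t [set w | below_far w] by apply: Ffar; exact: measurable_wrtB.
have h1 := mean_half _ _ Fabove measurable_above_far u1.
have h2 := mean_half _ _ Fbelow measurable_below_far u2.
have mUi (i : interval R) : measurable_fun setT (fun w => U w \in i).
  apply: (measurable_fun_bool true) => //.
  exact: (mU measurableT [set` i] (measurable_itv _)).
have b1 : bounded_measurable (fun w => (above_far w && (U w \in I1))%:R : R).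
  by apply/bounded_measurable_natr/measurable_and => //; exact: measurable_above_far.
have b2 : bounded_measurable (fun w => (below_far w && (U w \in I2))%:R : R).
  by apply/bounded_measurable_natr/measurable_and => //; exact: measurable_below_far.
have bz := bounded_good_mass.
have bb : bounded_measurable (fun w => (bad w)%:R : R).
  by apply/bounded_measurable_natr; exact: measurable_bad.
have : mean P (fun w => (above_far w && (U w \in I1))%:R + (below_far w && (U w \in I2))%:R)
   <= mean P (fun w => 2 * good_mass w + (bad w)%:R).
  apply: le_mean => [||w].
  - exact: bounded_measurableD.
  - by apply: bounded_measurableD => //; exact: bounded_measurableZ.
  - have /andP[z0 z1] := good_mass_bounds w.
    have far : (f0 (x t w) < y t w) && (y t w < m t w) || (m t w < y t w) && (y t w < f0 (x t w)) ->
        1 <= 2 * good_mass w + (bad w)%:R.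
      move=> yw.
      have o2 : 2^-1 <= opposed w.
        exact: opposed_mass_median p'_gt0 p'_lt2 N_gt0 (ma_median Halg w tT) yw.
      by rewrite /good_mass; case: (bad w); rewrite /= ?mul0r ?mulr0 ?add0r//; lra.
    move: far; rewrite /above_far /below_far /U !in_itv/= => far.
    (* The median cannot be far on both sides, so at most one indicator is 1. *)
    have [/andP[a1 /andP[a2 a3]]|] := boolP (_ && (- T%:R^-1 <= _ < 0)).
      rewrite (_ : 2 / T%:R < f0 (x t w) - m t w = false) ?andFb/= ?addr0.
        by apply: far; apply/orP; left; apply/andP; split; lra.
      by apply/negbTE; rewrite -leNgt; lra.
    have [/andP[a1 /andP[a2 a3]] _|_ _] := boolP (_ && (0 < _ <= T%:R^-1)).
      by rewrite add0r; apply: far; apply/orP; right; apply/andP; split; lra.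
    by rewrite addr0 addr_ge0// mulr_ge0.
rewrite !meanD//; last exact: bounded_measurableZ.
rewrite h1 h2 meanZ//.
by lra.
Qed.

Lemma median_dist w : `|m t w - f0 (x t w)| <= 1.
Proof.
apply: weighted_median_dist (ma_median Halg w tT) => f fN.
by apply: loss_le1 => //; case: NH => + _; exact.
Qed.

(** The offset is at most [1 / T] almost surely. The median is within [2 / T] of [f0] unless it is
    far, and within 1 in every case. *)
Lemma ae_round_regret_le : \forall w \ae P, `|y t w - f0 (x t w)| <=
  3 / T%:R + ((above_far w)%:R + (below_far w)%:R).
Proof.
have TV0 : 0 < T%:R^-1 :> R by rewrite invr_gt0.
pose I : interval R := `[- T%:R^-1, T%:R^-1].
have mUI : measurable (U @^-1` [set` I]).
  by rewrite -[X in measurable X]setTI; exact: (mU measurableT [set` I] (measurable_itv _)).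
exists (~` (U @^-1` [set` I])); split; first exact: measurableC.
  rewrite probability_setC// offset_law//.
  rewrite uniform_probE//.
  rewrite lebesgue_measure_itv/= lte_fin ifT; last by lra.
  rewrite [X in (_ * X)%E](_ : _ = (T%:R^-1 - - T%:R^-1)%:E)//.
  by rewrite -EFinM mulVf ?subee// gt_eqF//; lra.
move=> w /= nle; apply: contra_not nle; rewrite in_itv/= /U => /andP[u1 u2].
have d1 := median_dist w; move: d1; rewrite ler_norml => /andP[d1 d2].
rewrite ler_norml /above_far /below_far.
by case: ltP => a1; case: ltP => a2 /=; apply/andP; split; lra.
Qed.

End Round.

(** * Summation over the rounds *)

Let bounded_bad (t : 'I_T) : bounded_measurable (fun w => (bad t w)%:R : R).
Proof. exact/bounded_measurable_natr/measurable_bad. Qed.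

Let sum_bad_le1 : \sum_(t < T) mean P (fun w => (bad t w)%:R) <= 1.
Proof.
apply: (@le_trans _ _ (\sum_(t < T) T%:R^-1)).
  by apply: ler_sum => t _; exact: mean_bad_le.
by rewrite sumr_const card_ord -[leLHS]mulr_natl mulfV// gt_eqF.
Qed.

(* The progress made in a good round has mean [gain p p'] times the opposed mass,
   because the flip is independent of the opposed mass. *)
Lemma sum_good_mass_le : gain p p' * \sum_(t < T) mean P (good_mass t)
  <= ln #|` N|%:R + (1 - 2 * p') / p' * \sum_(t < T) mean P (fun w => (bad t w)%:R).
Proof.
have [g gN fg] : exists2 g, g \in N & (dinf f0 g <= eps%:E)%E by case: NH => _; exact.
(* These write [(1 - 2 * p') * progress] as [a - b * flip], affine in the flip indicator, so that
   its mean [a - b * p] is [gain p p']. *)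
pose a := (1 - 2 * p') / (1 - p'); pose b := a + (1 - 2 * p') / p'.
pose h (t : 'I_T) w := a * good_mass t w + - b * (good_mass t w * (flip t w)%:R).
have bz (t : 'I_T) : bounded_measurable (good_mass t) by exact: bounded_good_mass.
have bzf (t : 'I_T) : bounded_measurable (fun w => good_mass t w * (flip t w)%:R).
  by apply: bounded_measurableM => //; exact/bounded_measurable_natr/measurable_flip.
have bh (t : 'I_T) : bounded_measurable (h t).
  by apply: bounded_measurableD; exact: bounded_measurableZ.
have bB := bounded_measurable_sum _ _ bounded_bad.
have : mean P (fun w => \sum_(t < T) h t w) <=
    mean P (fun w => ln #|` N|%:R + (1 - 2 * p') / p' * \sum_(t < T) (bad t w)%:R).
  apply: le_mean => [||w].
  - exact: bounded_measurable_sum.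
  - apply: bounded_measurableD; first exact: bounded_measurable_cst.
    exact: bounded_measurableZ.
  - apply: le_trans (total_progress_le N p' (x^~ w) (y^~ w) (sigma^~ w) p'_gt0 p'_lt2 N_gt0
      f0 g eps (flip^~ w) T gN _ _ _).
    + apply: ler_sum => t _; rewrite /h /good_mass /bad /opposed /progress /b /a.
      by case: (flip t w); rewrite le_eqVlt; apply/orP; left; apply/eqP; rewrite /=; ring.
    + by move=> t _; exact: dinf_le.
    + by move=> t tT; exact: (nf_above Hfeedback).
    + by move=> t tT; exact: (nf_below Hfeedback).
rewrite mean_sum// meanD//; [|exact: bounded_measurable_cst|exact: bounded_measurableZ].
rewrite mean_cst meanZ// mean_sum//; apply: le_trans.
rewrite mulr_sumr; apply: ler_sum => t _.
rewrite meanD; [|exact: bounded_measurableZ|exact: bounded_measurableZ].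
rewrite !meanZ// mean_good_mass_flip//.
have p'0 : p' != 0 by rewrite gt_eqF.
have p'1 : 1 - p' != 0 by move: p'_lt2 => ?; rewrite gt_eqF//; lra.
rewrite le_eqVlt; apply/orP; left; apply/eqP.
by rewrite /b /a /gain; field; rewrite p'0.
Qed.

(** Summing [mean_far_le] leaves the total good mass, bounded through [sum_good_mass_le], and the
    expected number of bad rounds, at most 1. *)
Lemma sum_far_le :
  gain p p' * \sum_(t < T) (mean P (fun w => (above_far t w)%:R) +
                         mean P (fun w => (below_far t w)%:R))
  <= 4 * (ln #|` N|%:R + (1 - 2 * p') / p') + 2 * gain p p'.
Proof.
have K0 : 0 <= (1 - 2 * p') / p'.
  by move: p'_gt0 p'_lt2 => ? ?; rewrite divr_ge0//; lra.
have far : \sum_(t < T) (mean P (fun w => (above_far t w)%:R) +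
                         mean P (fun w => (below_far t w)%:R))
    <= 4 * \sum_(t < T) mean P (good_mass t) +
       2 * \sum_(t < T) mean P (fun w => (bad t w)%:R).
  by rewrite !mulr_sumr -big_split/=; apply: ler_sum => t _; exact: mean_far_le.
have := ler_wpM2l (ltW (gain_gt0 p p' p_ge0 ltpp' p'_lt2)) far.
have := sum_good_mass_le; have := ler_wpM2l K0 sum_bad_le1.
have := ler_wpM2l (ltW (gain_gt0 p p' p_ge0 ltpp' p'_lt2)) sum_bad_le1.
move: (\sum_(t < T) _) (\sum_(t < T) _) (\sum_(t < T) _) => E B S.
by move: (gain p p' * E) => gE; nra.
Qed.

Lemma expected_regret_le : (expected_regret P f0 T x y <=
  (3 + \sum_(t < T) (mean P (fun w => (above_far t w)%:R) +
                     mean P (fun w => (below_far t w)%:R)))%:E)%E.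
Proof.
pose h (t : 'I_T) w : R := 3 / T%:R + ((above_far t w)%:R + (below_far t w)%:R).
have bA (t : 'I_T) : bounded_measurable (fun w => (above_far t w)%:R : R).
  exact/bounded_measurable_natr/measurable_above_far.
have bB (t : 'I_T) : bounded_measurable (fun w => (below_far t w)%:R : R).
  exact/bounded_measurable_natr/measurable_below_far.
have bh (t : 'I_T) : bounded_measurable (h t).
  by apply: bounded_measurableD; [exact: bounded_measurable_cst|exact: bounded_measurableD].
have bH := bounded_measurable_sum _ _ bh.
have -> : 3 + \sum_(t < T) (mean P (fun w => (above_far t w)%:R) +
    mean P (fun w => (below_far t w)%:R)) = mean P (fun w => \sum_(t < T) h t w).
  rewrite mean_sum//; under [RHS]eq_bigr => t _.
    rewrite meanD; [|exact: bounded_measurable_cst|exact: bounded_measurableD].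
    rewrite mean_cst meanD//; over.
  rewrite [RHS]big_split/=; congr (_ + _).
  by rewrite sumr_const card_ord -[RHS]mulr_natr divfK// gt_eqF.
rewrite -mean_EFin// /expected_regret unlock.
have mr (t : 'I_T) : measurable_fun setT (fun w => `|y t w - f0 (x t w)|).
  apply: (@measurableT_comp _ _ _ _ _ _ (@Num.norm R R)) => //.
  apply: measurable_funB; first exact: measurable_guess.
  apply: (measurable_wrt_measurable (F t)); first exact: F_measurable.
  exact: (nf_context Hfeedback).
apply: ae_ge0_le_integral => //.
- by move=> w _; rewrite lee_fin sumr_ge0.
- by apply/measurable_EFinP; exact: measurable_sum.
- by move=> w _; rewrite lee_fin sumr_ge0// => t _; rewrite addr_ge0// divr_ge0.
- by apply/measurable_EFinP; case: bH.
- have : \forall w \ae P, forall t : 'I_T, `|y t w - f0 (x t w)| <= h t w.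
    by apply: filter_forall => t; exact: ae_round_regret_le.
  apply: filterS => w hw _; rewrite lee_fin; apply: ler_sum => t _; exact: hw.
Qed.

End Analysis.

(** For [T >= 2] the radius is below one half and the logarithm of its inverse is [2 * ln T]; the
    horizon [T = 1] is treated apart. *)
Lemma ln_card_min_cover_horizon_le {R : realType} {X : Type} (H : set (X -> R))
    (N : {fset (X -> R)}) (f0 : X -> R) (d : R) (T : nat) :
  (forall f g x, H f -> H g -> `|f x - g x| <= 1) -> Cdim H = d%:E -> H f0 ->
  (0 < T)%N -> is_min_cover ((T%:R ^+ 2)^-1) H N ->
  ln #|` N|%:R <= 2 * Num.max (d * ln T%:R) 1.
Proof.
move=> loss_le1 HCdim Hf0 T0 minN.
have N0 : (0 < #|` N|)%N by case: minN => cN _; exact: is_cover_card_gt0 cN Hf0.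
have [T2|] := leqP 2 T.
  have T2R : 2 <= T%:R :> R by rewrite ler_nat.
  have e2 : 0 < ((T%:R ^+ 2)^-1 : R) <= 2^-1.
    by rewrite invr_gt0 lef_pV2 ?posrE; first (apply/andP; split); nra.
  apply: le_trans (ln_card_min_cover_le H N d _ e2 N0 HCdim minN) _.
  rewrite invrK lnXn; last by lra.
  by rewrite -[ln _ *+ 2]mulr_natl mulrCA ler_pM2l// le_max lexx.
rewrite ltnS => T1; have {T0 T1} ET : T = 1%N by apply/eqP; rewrite eqn_leq T1.
(* The covering dimension says nothing about radius [1], but there [f0] alone covers H. *)
have : (#|` N| <= #|` [fset f0]%fset|)%N.
  case: minN => _; apply; split=> [f|h Hh]; first by rewrite inE => /eqP->.
  exists f0; first by rewrite inE.
  apply: ge_ereal_sup => _ [z _ <-].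
  by rewrite lee_fin ET expr1n invr1 loss_le1.
rewrite cardfs1 => N1; apply: (@le_trans _ _ 0).
  by rewrite ln_le0// lern1.
by rewrite mulr_ge0// le_max ler01 orbT.
Qed.

Theorem mainTheorem5 (R : realType) (p p' : R)
    (p_ge0 : 0 <= p) (ltpp' : p < p') (p'_lt2 : p' < 2^-1) :
  exists C : R, 0 < C /\
  forall (X : Type) (H : set (X -> R))
    (loss_le1 : forall f g x, H f -> H g -> `|f x - g x| <= 1)
    (d : R) (HCdim : Cdim H = d%:E)
    (f0 : X -> R) (Hf0 : H f0)
    (T : nat) (T_gt0 : (0 < T)%N)
    (N : {fset (X -> R)}) (HN : is_min_cover ((T%:R ^+ 2)^-1) H N)
    (disp : measure_display) (Omega : measurableType disp)
    (P : probability Omega R) (F : nat -> set (set Omega))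
    (x : nat -> Omega -> X) (m y sigma : nat -> Omega -> R)
    (flip : nat -> Omega -> bool)
    (Hfeedback : noisy_feedback P H f0 p T F x y flip sigma)
    (Halg : median_algorithm P N p' T_gt0 F x m y sigma),
  (expected_regret P f0 T x y <= (C * Num.max (d * ln T%:R) 1)%:E)%E.
Proof.
have gain0 := gain_gt0 p p' p_ge0 ltpp' p'_lt2.
have K0 : 0 < (1 - 2 * p') / p' by rewrite divr_gt0//; lra.
set K := (1 - 2 * p') / p' in K0.
(* With M the maximum in the bound, [4 * (2 * M + K)] is at most [(8 + 4 * K) * M] since [1 <= M].
   The 5 collects the 3 from near rounds and the 2 left after dividing [2 * gain p p'] by the
   gain. *)
exists (5 + (8 + 4 * K) / gain p p'); split.
  by rewrite addr_gt0// divr_gt0//; lra.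
move=> X H loss_le1 d HCdim f0 Hf0 T T_gt0 N HN disp Omega P F x m y sigma flip Hfeedback Halg.
have NH := HN.1.
have regret := expected_regret_le _ _ _ _ _ T_gt0 _ _ _ _ _ _ _ _
  loss_le1 Hf0 NH Hfeedback Halg.
apply: (le_trans regret).
have := sum_far_le _ _ _ _ _ T_gt0 _ _ _ _ _ _ _ _ p_ge0 ltpp' p'_lt2
  Hf0 NH Hfeedback Halg.
have := ln_card_min_cover_horizon_le _ _ _ _ _ loss_le1 HCdim Hf0 T_gt0 HN.
have : 1 <= Num.max (d * ln T%:R) 1 by rewrite le_max lexx orbT.
rewrite lee_fin -/K; set M := Num.max _ _; set E := \sum_(t < T) _ => M1 LM far.
have : E <= ((8 + 4 * K) * M + 2 * gain p p') / gain p p'.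
  by rewrite ler_pdivlMr// mulrC; apply: le_trans far _; nra.
rewrite mulrDl mulfK ?gt_eqF// => EM.
by rewrite mulrDl mulrAC; lra.
Qed.
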